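(* Let $0<q<1$, $1\le K<N$, $\varkappa\in\mathbb{GT}_K$, $\nu\in\mathbb{GT}_N$, and let $T=\{t_1<\dots<t_{N-K}\}\subset F:=\{0,1,\dots,N-1\}$ be any subset of size $N-K$. Put $S=F\setminus T$ and $S'=\{N-s: s\in S\}=\{s'_1<\dots<s'_K\}$. Then \[ \frac{s_{\nu/\varkappa}(q^{t_1},\dots,q^{t_{N-K}})}{s_\nu(1,q,q^2,\dots,q^{N-1})}=(-q^N)^{t_1+\dots+t_{N-K}}\cdot\frac{V(q^{-1},q^{-2},\dots,q^{-N})}{V(q^{t_1},\dots,q^{t_{N-K}})}\cdot\det\big[{}_q\psi^T_{s'_i}(\varkappa_j-j)\big]_{i,j=1}^K . \]
   Context: $\mathbb{GT}_N$ is the set of integer tuples $\nu=(\nu_1\ge\dots\ge\nu_N)$, $\mathbb{GT}_0=\{\varnothing\}$, $|\nu|=\sum\nu_r$. Interlacing $\mu\prec\nu$ for $\mu\in\mathbb{GT}_{m-1},\nu\in\mathbb{GT}_m$ means $\nu_1\ge\mu_1\ge\nu_2\ge\dots\ge\mu_{m-1}\ge\nu_m$; $\varnothing\prec\lambda$ for all $\lambda\in\mathbb{GT}_1$. For $0\le K<N$, $\varkappa\in\mathbb{GT}_K$, $\nu\in\mathbb{GT}_N$ the skew (Laurent–)Schur polynomial is \[ s_{\nu/\varkappa}(u_{K+1},\dots,u_N)=\sum_{\varkappa=\nu^{(K)}\prec\nu^{(K+1)}\prec\dots\prec\nu^{(N)}=\nu}\ \prod_{m=K+1}^N u_m^{|\nu^{(m)}|-|\nu^{(m-1)}|},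 \] and $s_\nu=s_{\nu/\varnothing}$. $V(a_1,\dots,a_n)=\prod_{1\le i<j\le n}(a_i-a_j)$ (equal to $1$ if $n=1$). $h_m$ is the complete homogeneous symmetric polynomial of degree $m$, with $h_0=1$ and $h_m=0$ for $m<0$. Let $W=[(q^{\nu_k-k})^{N-l}]_{k,l=1}^N$ be the Vandermonde matrix whose $k$th row corresponds to the node $q^{\nu_k-k}$ (these nodes are distinct), so that the $j$th column of $W^{-1}$ corresponds to the node $q^{\nu_j-j}$. For $i=1,\dots,N$ and $x\in\mathbb{Z}$ define \[ {}_q\psi^T_i(x)=\sum_{j=1}^N h_{\nu_j-j-x}(q^{t_1},\dots,q^{t_{N-K}})\,[W^{-1}]_{ij}. \] *)

(* Defs.v *)
From mathcomp Require Import all_boot all_order all_algebra.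
From mathcomp Require Import boolp classical_sets cardinality fsbigop.
From mathcomp Require Import zify.

Set Implicit Arguments.
Unset Strict Implicit.
Unset Printing Implicit Defensive.

Import Order.TTheory GRing.Theory Num.Theory.
Local Open Scope ring_scope.

(* Signatures and the other finite families are sequences indexed from 0, so
   the entry written nu_k (1 <= k <= N) is nu`_(k - 1). *)
Definition GT (n : nat) : {pred seq int} :=
  [pred nu : seq int | (size nu == n) && sorted >=%R nu].

Definition weight (nu : seq int) : int := \sum_(x <- nu) x.

(* The inequalities force mu and nu to be weakly decreasing, and they are
   vacuous when mu is empty. *)
Definition interlace (mu nu : seq int) : bool :=
  (size nu == (size mu).+1) &&
  [forall i : 'I_(size mu), nu`_i.+1 <= mu`_i <= nu`_i].

(* kappa :: c is the chain from kappa to nu, in n interlacing steps. *)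
Definition chains (n : nat) (kappa nu : seq int) : set (seq (seq int)) :=
  [set c | [/\ size c = n, path interlace kappa c & last kappa c = nu]]%classic.

(* The finitely supported sum is 0 on an infinite support; finite_chains below
   shows that this does not occur. *)
Definition skew_schur (R : fieldType) (nu kappa : seq int) (u : seq R) : R :=
  \sum_(c \in chains (size u) kappa nu)
    \prod_(m < size u)
      u`_m ^ (weight (nth [::] (kappa :: c) m.+1)
              - weight (nth [::] (kappa :: c) m)).

Definition schur (R : fieldType) (nu : seq int) (u : seq R) : R :=
  skew_schur nu [::] u.

Definition vdm (R : fieldType) (a : seq R) : R :=
  \prod_(i < size a) \prod_(j < size a | (i < j)%N) (a`_i - a`_j).

(* Sum over exponent vectors of total degree m; each exponent is then at most
   m, which makes the range finite. *)
Definition hcomp_nat (R : fieldType) (m : nat) (x : seq R) : R :=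
  \sum_(d : {ffun 'I_(size x) -> 'I_m.+1} | (\sum_i d i)%N == m)
    \prod_(i < size x) x`_i ^+ d i.

Definition hcomp (R : fieldType) (m : int) (x : seq R) : R :=
  if m is Posz k then hcomp_nat k x else 0.

Definition Wmx (R : fieldType) (q : R) (N : nat) (nu : seq int) : 'M[R]_N :=
  \matrix_(k < N, l < N) (q ^ (nu`_k - k.+1%:Z)) ^+ (N - l.+1).

(* enum lists a set of ordinals in increasing order. *)
Definition qpows (R : fieldType) (q : R) (N : nat) (T : {set 'I_N}) : seq R :=
  [seq q ^+ val t | t <- enum T].

Definition qpsi (R : fieldType) (q : R) (N : nat) (nu : seq int)
    (T : {set 'I_N}) (i : 'I_N) (x : int) : R :=
  \sum_(j < N) hcomp (nu`_j - j.+1%:Z - x) (qpows q T) * invmx (Wmx q N nu) i j.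

(* The set {N - s : s in F \ T} of 1-based row indices; as an element of 'I_N,
   the index N - s is N - s - 1 = rev_ord s. *)
Definition Sprime (N : nat) (T : {set 'I_N}) : {set 'I_N} :=
  [set rev_ord s | s in ~: T].

Lemma finite_interlace (nu : seq int) :
  finite_set [set mu | interlace mu nu]%classic.
Proof.
pose M := (\sum_(x <- nu) `|x|)%N; pose m := (size nu).-1.
pose F (f : {ffun 'I_m -> 'I_(M + M).+1}) : seq int :=
  [seq (f i : nat)%:Z - M%:Z | i <- enum 'I_m].
have leM x : x \in nu -> (`|x| <= M)%N.
  by move=> xnu; rewrite /M (big_rem x) //= leq_addr.
apply: (@sub_finite_set _ _ (F @` setT)%classic); last first.
  exact/finite_image/finite_finset.
move=> mu /= /andP[/eqP szmu /forallP mu_nu].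
have szm : size mu = m by rewrite /m szmu.
have muM (i : 'I_m) : (absz (mu`_i + M%:Z)%R < (M + M).+1)%N && (0 <= mu`_i + M%:Z).
  have lti : (i < size mu)%N by rewrite szm.
  have := mu_nu (Ordinal lti) => /=.
  have /leM : nu`_i \in nu by rewrite mem_nth // szmu ltnS ltnW.
  have /leM : nu`_i.+1 \in nu by rewrite mem_nth // szmu.
  move: (nu`_i) (nu`_i.+1) (mu`_i) => a b c; clear; lia.
exists [ffun i : 'I_m => inord (absz (mu`_i + M%:Z))] => //.
apply: (@eq_from_nth _ 0); first by rewrite size_map size_enum_ord szm.
move=> k; rewrite size_map size_enum_ord => ltk.
rewrite (nth_map (Ordinal ltk)) ?size_enum_ord //.
rewrite (_ : nth _ _ _ = Ordinal ltk); last by apply/val_inj; rewrite /= nth_enum_ord.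
have /andP[lt1 ge0] := muM (Ordinal ltk); rewrite ffunE inordK //=.
by move: ge0 => /=; lia.
Qed.

Lemma finite_chains (n : nat) (kappa nu : seq int) :
  finite_set (chains n kappa nu).
Proof.
elim: n nu => [|n IHn] nu.
  apply: (@sub_finite_set _ _ [set [::]]%classic); last exact: finite_set1.
  by move=> c [/size0nil].
apply: (@sub_finite_set _ _
    (\bigcup_(mu in [set mu | interlace mu nu])
       ((fun c => rcons c nu) @` chains n kappa mu))%classic); last first.
  apply: bigcup_finite; first exact: finite_interlace.
  by move=> mu _; apply: finite_image.
move=> c; case: (lastP c) => [|c' x] [] //.
rewrite size_rcons rcons_path last_rcons => -[szc] /andP[pc ilc] xnu.
by rewrite xnu in ilc *; exists (last kappa c') => //; exists c'.
Qed.

(* Main.v *)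
(** Removing the last variable v of s_{nu/kappa} amounts to summing over the
    signatures mu interlacing with nu.  The entries of such a mu range over
    independent intervals, so the sum of determinants in the mu_j - j is a
    determinant of column sums, and these telescope.  Induction on the number
    of variables gives, for u = (u_1, ..., u_n) and N = K + n,
      s_{nu/kappa}(u) V(u) = det [h_{nu_j - j - kappa_i + i}(u) ; u_m^{nu_j - j + N}],
    with K rows of the first kind and n rows of the second.  At u_m = q^{t_m}
    the rows of the second kind are multiples of columns of W, so that after
    multiplication by W^{-1} they become unit vectors, and expanding along them
    leaves the minor of the functions psi indexed by S', with sign
    (-1)^{t_1 + ... + t_n}.  The denominator is the case T = F, kappa empty. *)

Require Import Defs.
From mathcomp Require Import all_boot all_order all_algebra fingroup perm.
From mathcomp Require Import classical_sets fsbigop.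
From mathcomp Require Import zify ring.

Set Implicit Arguments.
Unset Strict Implicit.
Unset Printing Implicit Defensive.

Import Order.TTheory GRing.Theory Num.Theory.
Local Open Scope ring_scope.

(** * Interlacing signatures and the branching rule *)

Definition int_range (b a : int) : seq int :=
  [seq b + k%:Z | k <- iota 0 (if (a - b + 1)%R is Posz n then n else 0%N)].

Lemma mem_int_range (b a x : int) : (x \in int_range b a) = (b <= x <= a).
Proof.
apply/mapP/idP => [[k]|bxa].
  rewrite mem_iota add0n; case E: (a - b + 1) => [n|n]; lia.
exists `|x - b|%N; last by lia.
by rewrite mem_iota add0n; case E: (a - b + 1) => [n|n]; lia.
Qed.

Lemma int_range_uniq (b a : int) : uniq (int_range b a).
Proof. by rewrite map_inj_uniq ?iota_uniq// => x y; lia. Qed.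

Lemma telescope_int_range (V : zmodType) (F : int -> V) (b a : int) :
  b <= a -> \sum_(x <- int_range b a) (F x - F (x - 1)) = F a - F (b - 1).
Proof.
move=> le_ba; rewrite big_map.
have -> : a = b + `|a - b|%N%:Z by lia.
have -> : b + `|a - b|%N%:Z - b + 1 = Posz `|a - b|.+1 by lia.
move: `|a - b|%N => n; elim: n => [|n IHn].
  by rewrite big_seq1 addr0.
rewrite -[n.+2]addn1 iotaD big_cat /= IHn big_seq1 add0n.
have -> : b + n.+1%:Z - 1 = b + n%:Z by lia.
by rewrite [LHS]addrC addrA subrK.
Qed.

(** A repetition-free enumeration in product form: the head of [mu] is chosen independently of its
    tail. The empty tuple has no predecessor. *)
Fixpoint interlacing (nu : seq int) : seq (seq int) :=
  if nu is a :: l then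
    if l is b :: _ then
      [seq x :: mu | x <- int_range b a, mu <- interlacing l]
    else [:: [::]]
  else [::].

Lemma interlaceP (mu nu : seq int) :
  reflect (size nu = (size mu).+1 /\
           forall i, (i < size mu)%N -> nu`_i.+1 <= mu`_i <= nu`_i)
          (interlace mu nu).
Proof.
apply: (iffP andP) => -[/eqP sz H]; split=> //; first last.
- by apply/forallP => i; apply: H.
- by move=> i lti; move/forallP/(_ (Ordinal lti)): H.
Qed.

Lemma interlace_cons (x a b : int) (mu l : seq int) :
  interlace (x :: mu) (a :: b :: l) = (b <= x <= a) && interlace mu (b :: l).
Proof.
apply/interlaceP/andP => [[[sz] H]|[bxa /interlaceP[[sz] H]]].
  split; first exact: (H 0).
  by apply/interlaceP; split; [rewrite /= sz|move=> i; apply: (H i.+1)].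
split; first by rewrite /= sz.
by case=> [//|i] lti; apply: (H i).
Qed.

Lemma mem_interlacing (mu nu : seq int) :
  (mu \in interlacing nu) = interlace mu nu.
Proof.
elim: nu mu => [|a [|b l] IHl] mu.
- by apply/esym/negbTE/negP => /interlaceP[].
- rewrite inE; apply/eqP/interlaceP => [->//|[[]]].
  by case: mu.
have -> : interlacing (a :: b :: l) =
  [seq x :: mu | x <- int_range b a, mu <- interlacing (b :: l)] by [].
case: mu => [|x mu].
  by apply/negbTE/negP => /allpairsP[[y m] []].
rewrite interlace_cons -IHl -mem_int_range.
apply/allpairsP/andP => [[[y m] /= [? ? [-> ->]]]//|[]].
by exists (x, mu).
Qed.

Lemma interlacing_uniq (nu : seq int) : uniq (interlacing nu).
Proof.
elim: nu => [|a [|b l] IHl] //.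
apply: allpairs_uniq => //; first exact: int_range_uniq.
by case=> [x m] [y n] _ _ [-> ->].
Qed.

Lemma interlaceGT (n : nat) (mu nu : seq int) :
  nu \in GT n.+1 -> interlace mu nu -> mu \in GT n.
Proof.
rewrite !inE => /andP[/eqP sz _] /interlaceP[sz' H].
have -> : size mu = n by move: sz; rewrite sz' => -[].
rewrite eqxx /=; apply/(sortedP 0) => i lti.
have /andP[_ H1] := H i.+1 lti; have /andP[H2 _] := H i (ltnW lti).
exact: le_trans H1 H2.
Qed.

(** Chains are built from their upper end, so that the recursion mirrors the removal of the last
    variable. *)
Fixpoint chain_seq (n : nat) (kappa nu : seq int) : seq (seq (seq int)) :=
  if n is n'.+1 then
    [seq rcons c nu | mu <- interlacing nu, c <- chain_seq n' kappa mu]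
  else if kappa == nu then [:: [::]] else [::].

Lemma mem_chain_seq (n : nat) (kappa nu : seq int) (c : seq (seq int)) :
  c \in chain_seq n kappa nu <-> chains n kappa nu c.
Proof.
elim: n nu c => [|n IHn] nu c /=.
  split; first by case: eqP => // <-; rewrite inE => /eqP->.
  by case=> /size0nil -> _ /= ->; rewrite eqxx inE.
split.
  case/allpairsPdep => mu [c' [+ /IHn[szc pc lc] ->]].
  rewrite mem_interlacing => ilm.
  split; rewrite ?size_rcons ?szc ?last_rcons//.
  by rewrite rcons_path pc lc.
case: (lastP c) => [|c' x] [] //.
rewrite size_rcons rcons_path last_rcons => -[szc] /andP[pc ilc] xnu.
apply/allpairsPdep; exists (last kappa c'), c'.
by rewrite mem_interlacing -xnu; split=> //; apply/IHn.
Qed.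

Lemma chain_seq_uniq (n : nat) (kappa nu : seq int) :
  uniq (chain_seq n kappa nu).
Proof.
elim: n nu => [|n IHn] nu /=; first by case: ifP.
apply: allpairs_uniq_dep => [|mu _|]; rewrite ?interlacing_uniq//.
(* The signature just below [nu] is the last entry of [kappa :: c], so [rcons c nu] determines both
   [mu] and [c]. *)
pose st := [seq existT (fun=> seq (seq int)) mu c
             | mu <- interlacing nu, c <- chain_seq n kappa mu].
have mem_st (p : {_ : seq int & seq (seq int)}) : p \in st ->
    last kappa (tagged p) = tag p.
  by case/allpairsPdep=> [mu [c [_ /mem_chain_seq[_ _ lc] ->]]].
case=> [m1 c1] [m2 c2] /mem_st /= <- /mem_st /= <-.
by case/rcons_inj => ->.
Qed.

Section SkewSchur.
Variable R : fieldType.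
Implicit Types (u : seq R) (v : R) (kappa nu : seq int).

Definition chain_weight u kappa (c : seq (seq int)) : R :=
  \prod_(m < size u)
    u`_m ^ (weight (nth [::] (kappa :: c) m.+1)
            - weight (nth [::] (kappa :: c) m)).

Lemma skew_schurE nu kappa u :
  skew_schur nu kappa u
  = \sum_(c <- chain_seq (size u) kappa nu) chain_weight u kappa c.
Proof.
rewrite fsbig_seq ?chain_seq_uniq//; apply: eq_fsbigl.
by apply/seteqP; split=> c /mem_chain_seq.
Qed.

Lemma skew_schur_nil nu kappa :
  skew_schur nu kappa ([::] : seq R) = (kappa == nu)%:R.
Proof.
rewrite skew_schurE /=; case: ifP => _; last by rewrite big_nil.
by rewrite big_seq1 /chain_weight big_ord0.
Qed.

(** Branching rule: chains are grouped by their penultimate signature [mu], and the last step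
    contributes the power of [v]. *)
Lemma skew_schur_rcons nu kappa u v :
  skew_schur nu kappa (rcons u v)
  = \sum_(mu <- interlacing nu)
      v ^ (weight nu - weight mu) * skew_schur mu kappa u.
Proof.
rewrite skew_schurE size_rcons /= big_allpairs_dep /=.
apply: eq_bigr => mu _; rewrite skew_schurE big_distrr /=.
apply: eq_big_seq => c /mem_chain_seq[szc _ lc].
rewrite /chain_weight size_rcons big_ord_recr /= mulrC.
rewrite !nth_rcons ltnn eqxx szc ltnn eqxx.
have -> : nth [::] (kappa :: rcons c nu) (size u) = mu.
  by rewrite -lc -rcons_cons nth_rcons /= szc ltnS leqnn -szc nth_last.
congr (_ * _); apply: eq_bigr => m _.
rewrite !nth_rcons ltn_ord szc ltn_ord.
by rewrite -rcons_cons nth_rcons /= szc ltnS ltnW.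
Qed.

End SkewSchur.

(** * Determinants *)

Section Determinants.
Variable R : comNzRingType.

(** Right multiplication by the unitriangular matrix [D] subtracts from each column its successor.
    The constant last row becomes (0, ..., 0, c), and expanding along it gives the right-hand
    side. *)
Lemma det_sub_next_col (n : nat) (b : nat -> nat -> R) (c : R) :
  \det (\matrix_(i < n.+1, j < n.+1) (if (i < n)%N then b i j else c))
  = c * \det (\matrix_(i < n, j < n) (b i j - b i j.+1)).
Proof.
set M := \matrix_(i, j) _.
pose D : 'M[R]_n.+1 := \matrix_(k, j) ((k == j)%:R - (k == j.+1 :> nat)%:R).
have detD : \det D = 1.
  rewrite det_trig; last first.
    apply/is_trig_mxP => i j ltij; rewrite mxE -val_eqE /= ltn_eqF //.
    by rewrite ltn_eqF ?subrr// ltnS ltnW.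
  by apply: big1 => i _; rewrite mxE eqxx ltn_eqF // subr0.
rewrite -[LHS]mulr1 -detD -det_mulmx (expand_det_row _ ord_max).
have MD (i j : 'I_n.+1) : (j < n)%N ->
    (M *m D) i j = if (i < n)%N then b i j - b i j.+1 else 0.
  move=> ltj; rewrite mxE.
  under eq_bigr do rewrite [D _ _]mxE mulrBr.
  rewrite sumrB (bigD1 j) //= eqxx mulr1 big1 ?addr0; last first.
    by move=> k /negbTE->; rewrite mulr0.
  have ltj1 : (j.+1 < n.+1)%N by [].
  rewrite (bigD1 (Ordinal ltj1)) //= eqxx mulr1 big1 ?addr0; last first.
    by move=> k nk; rewrite (_ : _ == _ :> nat = false) ?mulr0//; apply/negbTE.
  by rewrite !mxE /=; case: ifP => // _; rewrite subrr.
have MDmax : (M *m D) ord_max ord_max = c.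
  rewrite mxE (bigD1 ord_max) //= big1 ?addr0.
    by rewrite !mxE ltnn eqxx ltn_eqF // subr0 mulr1.
  move=> k nk; rewrite [D _ _]mxE (negbTE nk) (ltn_eqF (ltn_ord k)).
  by rewrite subrr mulr0.
rewrite (bigD1 ord_max) //= big1 ?addr0; last first.
  move=> k nk; rewrite MD ?ltnn ?mul0r//.
  by rewrite ltn_neqAle -ltnS ltn_ord andbT.
rewrite MDmax /cofactor addnn -mul2n exprM sqrrN !expr1n mul1r.
congr (_ * \det _); apply/matrixP => i j; rewrite [LHS]mxE [LHS]mxE.
have bumpn (k : 'I_n) : bump n k = k by rewrite /bump leqNgt ltn_ord.
by rewrite MD /= ?bumpn ?ltn_ord// mxE.
Qed.

Lemma det_scale_rows (n : nat) (a : 'I_n -> R) (F : 'I_n -> 'I_n -> R) :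
  \det (\matrix_(i, j) (a i * F i j)) = (\prod_i a i) * \det (\matrix_(i, j) F i j).
Proof.
have -> : \matrix_(i, j) (a i * F i j)
    = diag_mx (\row_i a i) *m \matrix_(i, j) F i j.
  by apply/matrixP => i j; rewrite mul_diag_mx !mxE.
by rewrite det_mulmx det_diag; congr (_ * _); apply: eq_bigr => i; rewrite mxE.
Qed.

Lemma det_scale_cols (n : nat) (a : 'I_n -> R) (F : 'I_n -> 'I_n -> R) :
  \det (\matrix_(i, j) (a j * F i j)) = (\prod_i a i) * \det (\matrix_(i, j) F i j).
Proof.
rewrite -det_tr -[\det (\matrix_(i, j) F i j)]det_tr.
have -> : (\matrix_(i, j) F i j)^T = \matrix_(i, j) F j i.
  by apply/matrixP => i j; rewrite !mxE.
rewrite -det_scale_rows; congr (\det _).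
by apply/matrixP => i j; rewrite !mxE.
Qed.

(** Distributivity over independent entries. The family [F] is indexed by [nat] so that the
    induction can shift it. *)
Lemma sum_interlacing_prod (n : nat) (nu : seq int) (F : nat -> int -> R) :
  size nu = n.+1 ->
  \sum_(mu <- interlacing nu) \prod_(j < n) F j mu`_j
  = \prod_(j < n) \sum_(x <- int_range nu`_j.+1 nu`_j) F j x.
Proof.
elim: n nu F => [|n IHn] [|a [|b l]] F //= sz.
  by rewrite big_seq1 !big_ord0.
have {}IHn := IHn (b :: l) (fun j => F j.+1) (succn_inj sz).
rewrite big_allpairs_dep big_ord_recl /= -IHn big_distrl /=; apply: eq_bigr => x _.
by rewrite big_distrr /=; apply: eq_bigr => mu _; rewrite big_ord_recl.
Qed.

(* The interlacing inequalities bound each entry of mu separately, so the sum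
   over mu may be taken inside each column of the determinant. *)
Lemma sum_interlacing_det (n : nat) (nu : seq int) (F : nat -> nat -> int -> R) :
  size nu = n.+1 ->
  \sum_(mu <- interlacing nu) \det (\matrix_(i < n, j < n) F i j mu`_j)
  = \det (\matrix_(i < n, j < n)
             \sum_(x <- int_range nu`_j.+1 nu`_j) F i j x).
Proof.
move=> sz; rewrite -[RHS]det_tr /determinant exchange_big /=.
(* The products are reindexed by the inverse permutation to run over columns, because column [j]
   involves only the [j]-th entry of [mu]. *)
under [LHS]eq_bigr => s _.
  rewrite -big_distrr /=.
  under eq_bigr => mu _.
    rewrite (reindex_inj (@perm_inj _ s^-1%g)) /=.
    under eq_bigr do rewrite mxE permKV.
    over.
  over.
rewrite (reindex_inj invg_inj) /=; apply: eq_bigr => s _.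
rewrite odd_permV invgK; congr (_ * _).
(* [G] extends the family [F (s j) j] from ordinals to all naturals, by 0, as the product formula
   requires. *)
pose G j x := oapp (fun k : 'I_n => F (s k) j x) 0 (insub j).
have GE (j : 'I_n) x : F (s j) j x = G j x by rewrite /G valK.
under eq_bigr do under eq_bigr do rewrite GE.
rewrite sum_interlacing_prod //; apply: eq_bigr => j _; rewrite !mxE.
by apply: eq_bigr => x _; rewrite GE.
Qed.

End Determinants.

(** * Complete homogeneous polynomials and Vandermonde products *)

Section HcompVdm.
Variable R : fieldType.
Implicit Types (u : seq R) (v : R).

(** The series 1 / (1 - a X) truncated after degree [M]. Products over [u] generate the complete
    homogeneous polynomials up to that degree. *)
Definition geom_poly (M : nat) (a : R) : {poly R} := \poly_(k < M.+1) a ^+ k.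

Lemma geom_polyE (M : nat) (a : R) :
  (1 - a *: 'X) * geom_poly M a = 1 - a ^+ M.+1 *: 'X^(M.+1).
Proof.
have -> : geom_poly M a = \sum_(k < M.+1) (a *: 'X) ^+ k.
  by rewrite /geom_poly poly_def; apply: eq_bigr => k _; rewrite exprZn.
by rewrite -opprB mulNr -subrX1 opprB exprZn.
Qed.

Lemma hcomp_natE (m : nat) u : hcomp_nat m u = (\prod_(a <- u) geom_poly m a)`_m.
Proof.
rewrite (big_nth 0) big_mkord.
under eq_bigr do rewrite /geom_poly poly_def.
rewrite bigA_distr_bigA /= coef_sum /hcomp_nat [LHS]big_mkcond /=.
apply: eq_bigr => d _.
under [in RHS]eq_bigr do rewrite -mul_polyC.
rewrite big_split /= prodrXr -rmorph_prod /= mul_polyC coefZ coefXn.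
by rewrite eq_sym; case: eqP; rewrite ?mulr1 ?mulr0.
Qed.

(** Only terms of degree at most [j] enter the coefficient of degree [j], so any truncation at or
    beyond [j] gives the same value. *)
Lemma coef_prod_geom_poly u (m M j : nat) : (j <= m)%N -> (m <= M)%N ->
  (\prod_(a <- u) geom_poly m a)`_j = (\prod_(a <- u) geom_poly M a)`_j.
Proof.
move=> ltj lemM; elim: u j ltj => [|a u IHu] j lej; first by rewrite !big_nil.
rewrite !big_cons !coefM; apply: eq_bigr => i _.
rewrite IHu ?(leq_trans (leq_subr _ _))// !coef_poly.
have lei : (i <= m)%N by rewrite (leq_trans _ lej) // -ltnS.
by rewrite !ltnS lei (leq_trans lei).
Qed.

(** Multiplying the generating function by 1 - v X removes the variable [v]; the error due to
    truncation is divisible by X^(m+1) and does not reach degree [m]. *)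
Lemma hcomp_rcons (m : int) u v :
  hcomp m (rcons u v) - v * hcomp (m - 1) (rcons u v) = hcomp m u.
Proof.
case: m => [m|m]; last first.
  have -> : Negz m - 1 = Negz m.+1 by lia.
  by rewrite /= mulr0 subrr.
have rec : ((1 - v *: 'X) * \prod_(a <- rcons u v) geom_poly m a)`_m
    = (\prod_(a <- u) geom_poly m a)`_m.
  rewrite -cats1 big_cat big_seq1 /= mulrC -mulrA [geom_poly m v * _]mulrC.
  rewrite geom_polyE mulrBr mulr1 coefB -scalerAr coefZ coefMXn ltnSn mulr0.
  by rewrite subr0.
rewrite [hcomp m _]hcomp_natE [in RHS]/= hcomp_natE -rec.
rewrite mulrBl mul1r coefB; congr (_ - _).
rewrite -scalerAl coefZ coefXM; congr (_ * _).
case: m {rec} => [//|m].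
have -> : m.+1%:Z - 1 = Posz m by lia.
by rewrite /= hcomp_natE; apply: coef_prod_geom_poly.
Qed.

Lemma hcomp_nil (m : int) : hcomp m ([::] : seq R) = (m == 0)%:R.
Proof.
by case: m => [m|m] //=; rewrite hcomp_natE big_nil coef1.
Qed.

Lemma vdm_rcons u v :
  vdm (rcons u v) = vdm u * \prod_(i < size u) (u`_i - v).
Proof.
rewrite /vdm size_rcons big_ord_recr /= [X in _ * X]big1 ?mulr1; last first.
  by move=> j; rewrite ltnNge -ltnS ltn_ord.
rewrite -big_split /=; apply: eq_bigr => i _.
rewrite big_mkcond big_ord_recr /= ltn_ord -big_mkcond /=.
rewrite !nth_rcons ltn_ord ltnn eqxx; congr (_ * _); apply: eq_bigr => j _.
by rewrite nth_rcons ltn_ord.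
Qed.

Lemma vdm_neq0 u : uniq u -> vdm u != 0.
Proof.
move=> uu; apply/prodf_neq0 => i _; apply/prodf_neq0 => j ltij.
by rewrite subr_eq0 nth_uniq // ltn_eqF.
Qed.

End HcompVdm.

(** * The determinantal formula *)

Lemma GT_node_lt (n : nat) (nu : seq int) (i j : nat) :
  nu \in GT n -> (i < j < n)%N -> nu`_j - j.+1%:Z < nu`_i - i.+1%:Z.
Proof.
rewrite inE => /andP[/eqP <- nu_sorted] /andP[ltij ltj].
suff : nu`_j <= nu`_i by lia.
apply: (sorted_leq_nth ge_trans ge_refl 0 nu_sorted) (ltnW ltij) => //.
by rewrite inE (ltn_trans ltij ltj).
Qed.

Lemma GT_node_inj (n : nat) (nu : seq int) (i j : 'I_n) :
  nu \in GT n -> nu`_i - i.+1%:Z = nu`_j - j.+1%:Z -> i = j.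
Proof.
move=> nuGT eqij; apply/val_inj/eqP; rewrite eqn_leq.
apply/andP; split; rewrite leqNgt; apply/negP => lt;
  by have := GT_node_lt nuGT (introT andP (conj lt (ltn_ord _))); rewrite eqij ltxx.
Qed.

Definition nodes (n : nat) (nu : seq int) : seq int :=
  mkseq (fun i => nu`_i - i.+1%:Z) n.

Lemma nodes_sorted (n : nat) (nu : seq int) :
  nu \in GT n -> sorted >%R (nodes n nu).
Proof.
move=> nuGT; apply/(sortedP 0) => i; rewrite size_mkseq => lti.
by rewrite !nth_mkseq ?(ltnW lti)//; apply: (GT_node_lt nuGT); rewrite ltnSn.
Qed.

(** A strictly decreasing list is determined by its set of entries. *)
Lemma nodes_inj (n : nat) (mu nu : seq int) :
  mu \in GT n -> nu \in GT n -> nodes n mu =i nodes n nu -> mu = nu.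
Proof.
move=> muGT nuGT eqmn.
have gt_trans : transitive (>%R : rel int) by move=> x y z /= yx /lt_trans; apply.
have E : nodes n mu = nodes n nu.
  by apply: (irr_sorted_eq gt_trans) => //; [exact: ltxx|exact: nodes_sorted..].
move: muGT nuGT; rewrite !inE => /andP[/eqP szmu _] /andP[/eqP sznu _].
apply: (@eq_from_nth _ 0) => [|i]; rewrite szmu // => lti.
by have := congr1 (nth 0 ^~ i) E; rewrite !nth_mkseq // => /addIr.
Qed.

(** The determinantal formula without variables. For equal signatures the matrix is the identity;
    otherwise a nonzero term of the expansion would match the two sets of nodes. *)
Lemma det_nodes (R : comNzRingType) (n : nat) (kappa nu : seq int) :
  kappa \in GT n -> nu \in GT n ->
  \det (\matrix_(i < n, j < n)
     (nu`_j - j.+1%:Z - (kappa`_i - i.+1%:Z) == 0)%:R : 'M[R]_n)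
  = (kappa == nu)%:R.
Proof.
move=> kGT nGT; case: eqP => [->|neq].
  rewrite -[RHS](det1 R n); congr (\det _); apply/matrixP => i j.
  rewrite !mxE subr_eq0; congr (_%:R); congr nat_of_bool.
  by apply/eqP/eqP => [/(GT_node_inj nGT)->|->].
apply: big1 => s _.
have [/forallP eqs|/forallPn[i]] :=
    boolP [forall i : 'I_n, nu`_(s i) - (s i).+1%:Z == kappa`_i - i.+1%:Z].
  case: neq; apply: (nodes_inj kGT nGT) => x.
  apply/mapP/mapP => -[i]; rewrite mem_iota add0n => /= lti ->.
    exists (val (s (Ordinal lti))); rewrite ?mem_iota ?ltn_ord//.
    by rewrite (eqP (eqs _)).
  exists (val ((s^-1)%g (Ordinal lti))); rewrite ?mem_iota ?ltn_ord//.
  by rewrite -(eqP (eqs _)) permKV.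
move=> neqi; rewrite (bigD1 i) //= mxE subr_eq0 (negbTE neqi).
by rewrite mul0r mulr0.
Qed.

Section Determinantal.
Variable R : fieldType.
Implicit Types (u : seq R) (v : R) (kappa nu : seq int).

Lemma exprz_sum (I : Type) (r : seq I) (a : I -> int) v : v != 0 ->
  v ^ (\sum_(i <- r) a i) = \prod_(i <- r) v ^ (a i).
Proof.
by move=> v0; apply: (big_morph (exprz v)) => // x y; rewrite expfzDr.
Qed.

Lemma weightE (n : nat) nu : size nu = n -> weight nu = \sum_(j < n) nu`_j.
Proof. by move=> <-; rewrite /weight (big_nth 0) big_mkord. Qed.

(** One step of the branching rule on determinants. The power of [v] is distributed over the
    columns; by the relation between [f] and [g] each column sum telescopes to a difference of
    consecutive columns built from [g], and the row [g n] restores the larger determinant. *)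
Lemma interlacing_step (n : nat) nu v (f g : nat -> int -> R) :
  v != 0 -> nu \in GT n.+1 ->
  (forall i y, (i < n)%N -> g i y - v * g i (y - 1) = f i y) ->
  (forall y, g n y = v ^ (y + n.+1%:Z)) ->
  \sum_(mu <- interlacing nu) v ^ (weight nu - weight mu)
     * \det (\matrix_(i < n, j < n) f i (mu`_j - j.+1%:Z))
  = \det (\matrix_(i < n.+1, j < n.+1) g i (nu`_j - j.+1%:Z)).
Proof.
move=> v0 nuGT gf gn.
have /andP[/eqP sznu _] := nuGT.
(* With this power of [v] the row [g n] becomes constant, equal to v^n. *)
pose b i j := v ^ (j%:Z - nu`_j) * g i (nu`_j - j.+1%:Z).
have LE mu : mu \in interlacing nu ->
    v ^ (weight nu - weight mu)
      * \det (\matrix_(i < n, j < n) f i (mu`_j - j.+1%:Z))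
    = v ^ weight nu
      * \det (\matrix_(i < n, j < n) (v ^ (- mu`_j) * f i (mu`_j - j.+1%:Z))).
  rewrite mem_interlacing => /interlaceP[szmu _].
  rewrite det_scale_cols mulrA; congr (_ * _).
  rewrite expfzDr // (@weightE n mu); last by move: sznu; rewrite szmu => -[].
  by rewrite -sumrN; congr (_ * _); rewrite exprz_sum.
rewrite (eq_big_seq _ LE) -big_distrr /=.
rewrite (sum_interlacing_det (fun i j x => v ^ (- x) * f i (x - j.+1%:Z))) //.
have -> : \matrix_(i < n, j < n) \sum_(x <- int_range nu`_j.+1 nu`_j)
              v ^ (- x) * f i (x - j.+1%:Z)
    = \matrix_(i < n, j < n) (v ^ (- j%:Z) * (b i j - b i j.+1)).
  apply/matrixP => i j; rewrite !mxE.
  pose F x := v ^ (- x) * g i (x - j.+1%:Z).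
  (* At the lower boundary the argument of [g] is the node of column [j.+1], which makes the two
     terms entries of neighbouring columns. *)
  have -> : v ^ (- j%:Z) * (b i j - b i j.+1) = F nu`_j - F (nu`_j.+1 - 1).
    rewrite mulrBr /F /b !mulrA -!expfzDr //.
    congr (v ^ _ * _ - v ^ _ * g _ _); lia.
  rewrite -telescope_int_range; last first.
    have := @GT_node_lt _ _ j j.+1 nuGT; rewrite ltnSn ltnS ltn_ord; lia.
  apply: eq_bigr => x _; rewrite -gf // /F mulrBr; congr (_ - _).
  have -> : v ^ (- (x - 1)) = v ^ (- x) * v ^ 1.
    by rewrite -expfzDr //; congr (v ^ _); lia.
  by rewrite expr1z -mulrA; congr (_ * (v * g _ _)); lia.
rewrite det_scale_cols.
have -> : \matrix_(i < n.+1, j < n.+1) g i (nu`_j - j.+1%:Z)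
    = \matrix_(i < n.+1, j < n.+1)
        (v ^ (nu`_j - j%:Z) * (if (i < n)%N then b i j else v ^ n)).
  apply/matrixP => i j; rewrite !mxE; case: ltnP => [lti|lei].
    rewrite /b mulrA -expfzDr //.
    have -> : nu`_j - j%:Z + (j%:Z - nu`_j) = 0 by lia.
    by rewrite expr0z mul1r.
  have -> : nat_of_ord i = n by apply/eqP; rewrite eqn_leq lei -ltnS ltn_ord.
  by rewrite gn -expfzDr //; congr (v ^ _); lia.
rewrite det_scale_cols det_sub_next_col !mulrA; congr (_ * _).
rewrite (weightE sznu) -!exprz_sum // -!expfzDr //; congr (v ^ _).
by rewrite sumrB [X in _ = _ - X + _]big_ord_recr /= sumrN; ring.
Qed.

(** Jacobi-Trudi rows for the parts of [kappa], followed by the alternant rows of the bialternant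
    formula; [y] stands for a node nu_j - j. *)
Definition jt_row kappa u (N i : nat) (y : int) : R :=
  if (i < size kappa)%N then hcomp (y - (kappa`_i - i.+1%:Z)) u
  else u`_(i - size kappa) ^ (y + N%:Z).

Lemma skew_schur_det kappa u nu (K N : nat) :
  kappa \in GT K -> nu \in GT N -> N = (K + size u)%N -> all (predC1 0) u ->
  skew_schur nu kappa u * vdm u
  = \det (\matrix_(i < N, j < N) jt_row kappa u N i (nu`_j - j.+1%:Z)).
Proof.
move=> kGT; have /andP[/eqP szk _] := kGT.
elim/last_ind: u nu N => [|u v IHu] nu N nGT.
  rewrite addn0 => EN _; rewrite EN in nGT *.
  rewrite skew_schur_nil /vdm big_ord0 mulr1 -(@det_nodes _ K) //.
  congr (\det _); apply/matrixP => i j.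
  by rewrite !mxE /jt_row szk ltn_ord hcomp_nil.
rewrite size_rcons addnS all_rcons => EN /andP[/= v0 u0].
rewrite EN in nGT *; set n := (K + size u)%N in nGT *.
(* These are the new factors of the Vandermonde product, put on the alternant rows: u^(y+n+1) - v
   u^(y+n) = (u - v) u^(y+n). *)
pose c i := if (i < K)%N then 1 else u`_(i - K) - v.
rewrite -(@interlacing_step n nu v (fun i y => c i * jt_row kappa u n i y)) //.
- rewrite skew_schur_rcons vdm_rcons big_distrl /=; apply: eq_big_seq => mu.
  rewrite mem_interlacing => /(interlaceGT nGT) mGT.
  rewrite (@det_scale_rows _ n (fun i => c i)
    (fun i j => jt_row kappa u n i (mu`_j - j.+1%:Z))) -(IHu mu n) //.
  have -> : \prod_(i < n) c i = \prod_(i < size u) (u`_i - v).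
    rewrite big_split_ord /= big1 ?mul1r => [|i _]; last by rewrite /c ltn_ord.
    by apply: eq_bigr => i _; rewrite /c ltnNge leq_addr addKn.
  ring.
- move=> i y lti; rewrite /jt_row /c szk; case: ltnP => [ltiK|leKi].
    by rewrite mul1r -(hcomp_rcons _ u v) addrAC.
  have lt' : (i - K < size u)%N by rewrite ltn_subLR.
  rewrite !nth_rcons lt' mulrBl.
  have ui0 : u`_(i - K) != 0 by apply: (allP u0); rewrite mem_nth.
  congr (_ - v * _ ^ _); last by lia.
  by rewrite -[in RHS](expr1z u`_(i - K)) -expfzDr //; congr (_ ^ _); lia.
- move=> y; rewrite /jt_row szk ltnNge leq_addr addKn nth_rcons ltnn eqxx.
  by [].
Qed.

End Determinantal.

(** * Determinants with unit columns *)

Definition complement (N : nat) (t : seq nat) : seq nat :=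
  [seq s <- iota 0 N | s \notin t].

Lemma size_complement (N : nat) (t : seq nat) :
  uniq t -> all (ltn^~ N) t -> (size (complement N t) + size t)%N = N.
Proof.
move=> ut /allP tN; have := count_predC (mem t) (iota 0 N).
rewrite size_iota addnC => E; rewrite -[RHS]E /complement size_filter.
congr (_ + _)%N; rewrite -size_filter.
apply/perm_size/uniq_perm => //; first by rewrite filter_uniq ?iota_uniq.
move=> x; rewrite mem_filter mem_iota add0n /=.
by case xt: (x \in t) => //=; rewrite (tN x xt : (x < N)%N).
Qed.

(** [bump x] enumerates the naturals other than [x] and fixes the elements of [t], all of which lie
    below [x]. *)
Lemma complement_rcons (N x : nat) (t : seq nat) :
  (x <= N)%N -> all (ltn^~ x) t ->
  complement N.+1 (rcons t x) = map (bump x) (complement N t).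
Proof.
move=> lexN /allP tx; apply: (irr_sorted_eq ltn_trans ltnn).
- exact/(sorted_filter ltn_trans)/iota_ltn_sorted.
- apply: (homo_sorted (e := ltn)); last first.
    exact/(sorted_filter ltn_trans)/iota_ltn_sorted.
  by move=> i j /= ltij; rewrite /bump; lia.
move=> s; rewrite mem_filter mem_rcons inE negb_or mem_iota add0n /=.
apply/idP/mapP => [/andP[/andP[nsx nst] lts]|[r]]; last first.
  rewrite mem_filter mem_iota add0n /= => /andP[nrt ltr] ->.
  have -> : (bump x r < N.+1)%N by rewrite /bump; lia.
  rewrite andbT eq_sym neq_bump; apply: contra nrt => brt.
  have := tx _ brt; rewrite /= /bump => ltb.
  by move: brt; rewrite /bump (_ : (x <= r)%N = false) //; lia.
exists (unbump x s); last by rewrite unbumpK.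
rewrite mem_filter mem_iota add0n /=; apply/andP; split; last first.
  by rewrite /unbump; lia.
apply: contra nst => ust; have /= := tx _ ust; rewrite /unbump => ltu.
by move: ust; rewrite /unbump (_ : (x < s)%N = false) ?subn0//; lia.
Qed.

(* Expanding along the last column removes the row of the largest element of t
   and leaves the rows of the smaller ones with the same distance to the last
   row; this is why the sign is the parity of the plain sum of t. *)
Lemma det_unit_cols (R : comNzRingType) (K N : nat) (t : seq nat)
    (F : nat -> nat -> R) :
  N = (K + size t)%N -> sorted ltn t -> all (ltn^~ N) t ->
  \det (\matrix_(i < N, j < N)
          if (j < K)%N then F (N - i.+1)%N j
          else (N - i.+1 == nth 0 t (j - K))%N%:R)
  = (-1) ^+ sumn t
    * \det (\matrix_(i < K, j < K) F (nth 0 (rev (complement N t)) i)%N j).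
Proof.
elim/last_ind: t N F => [|t x IHt] N F.
  rewrite addn0 => -> _ _; rewrite mul1r; congr (\det _).
  apply/matrixP => i j; rewrite !mxE ltn_ord /complement filter_predT.
  rewrite nth_rev ?size_iota // nth_iota ?add0n //.
  by rewrite ltn_subrL //= (leq_ltn_trans _ (ltn_ord i)).
rewrite size_rcons addnS => -> {N}; set N := (K + size t)%N.
move=> t_sorted; rewrite all_rcons /= => /andP[lexN _].
have tx : all (ltn^~ x) t.
  move: t_sorted; rewrite (sorted_pairwise ltn_trans) pairwise_rcons.
  by case/andP.
have {}t_sorted : sorted ltn t.
  by move: t_sorted; case: (t) => //= a t'; rewrite rcons_path => /andP[].
have ltx0 : (N - x < N.+1)%N by rewrite ltnS leq_subr.
rewrite (expand_det_col _ ord_max) (bigD1 (Ordinal ltx0)) //= big1 ?addr0.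
  rewrite mxE /= ltnNge leq_addr /= addKn nth_rcons ltnn eqxx.
  rewrite (_ : (N.+1 - (N - x).+1)%N = x) ?eqxx ?mul1r; last by lia.
  rewrite /cofactor /= sumn_rcons.
  (* Since x <= N, the exponent has the parity of [x]. *)
  have -> : (-1) ^+ (N - x + N) = (-1) ^+ x :> R.
    rewrite -signr_odd -[RHS]signr_odd; congr (_ ^+ _); congr nat_of_bool; lia.
  rewrite addnC exprD -mulrA; congr (_ * _).
  rewrite complement_rcons // -map_rev.
  have szc : size (rev (complement N t)) = K.
    have ut : uniq t by apply: (sorted_uniq ltn_trans ltnn).
    have tN : all (ltn^~ N) t by apply: sub_all tx => y /= /leq_trans; apply.
    by rewrite size_rev; apply/eqP; rewrite -(eqn_add2r (size t)) size_complement.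
  have -> : \matrix_(i < K, j < K)
       F (nth 0 [seq bump x s | s <- rev (complement N t)] i)%N j
     = \matrix_(i < K, j < K) F (bump x (nth 0 (rev (complement N t)) i))%N j.
    by apply/matrixP => i j; rewrite !mxE (nth_map 0%N) // szc.
  rewrite -(IHt N (fun s j => F (bump x s) j)) //; last first.
    by apply: sub_all tx => y /= /leq_trans; apply.
  congr (\det _); apply/matrixP => i j; rewrite !mxE /=.
  have -> : bump N j = j by rewrite /bump leqNgt ltn_ord.
  (* Deleting the row at distance [x] from the last one changes the distances of the others by
     [bump x]. *)
  have -> : (N.+1 - (bump (N - x) i).+1)%N = bump x (N - i.+1)%N.
    by have := ltn_ord i; rewrite /bump; lia.
  case: ltnP => // leKj.
  have ltj : (j - K < size t)%N by rewrite ltn_subLR.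
  rewrite nth_rcons ltj; congr (_%:R); congr nat_of_bool.
  have /= := allP tx _ (mem_nth 0%N ltj); rewrite /bump; lia.
move=> i ni; rewrite mxE /= ltnNge leq_addr /= addKn nth_rcons ltnn eqxx.
rewrite (_ : (_ == x)%N = false) ?mul0r//; apply/negbTE.
apply: contra ni => /eqP eqx; apply/eqP/val_inj => /=.
by have := ltn_ord i; lia.
Qed.


(** * Specialisation to powers of q *)

Section OrdinalSets.
Variables (N : nat) (T : {set 'I_N}).

Lemma val_enum_sorted (A : {set 'I_N}) : sorted ltn (map val (enum A)).
Proof.
rewrite sorted_map /enum_mem -enumT; apply: sorted_filter.
  by move=> x y z /=; apply: ltn_trans.
by rewrite -sorted_map val_enum_ord iota_ltn_sorted.
Qed.

Lemma complement_enum :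
  complement N (map val (enum T)) = map val (enum (~: T)).
Proof.
apply: (irr_sorted_eq ltn_trans ltnn); last 1 first.
- move=> s; rewrite mem_filter mem_iota add0n /=.
  apply/andP/mapP => [[nsT lts]|[l + ->]].
    exists (Ordinal lts) => //; rewrite mem_enum inE.
    by apply: contra nsT => sT; apply/mapP; exists (Ordinal lts); rewrite ?mem_enum.
  rewrite mem_enum inE ltn_ord => nlT; split=> //; apply: contra nlT.
  by rewrite mem_map ?mem_enum //; apply: val_inj.
- exact/(sorted_filter ltn_trans)/iota_ltn_sorted.
- exact: val_enum_sorted.
Qed.

(** The map s -> N - 1 - s reverses the order, hence the reversed list. *)
Lemma enum_Sprime : enum (Sprime T) = map (@rev_ord N) (rev (enum (~: T))).
Proof.
apply: (inj_map val_inj); apply: (irr_sorted_eq ltn_trans ltnn).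
- exact: val_enum_sorted.
- rewrite -map_comp map_rev rev_sorted sorted_map.
  have := val_enum_sorted (~: T); rewrite sorted_map; apply: sub_sorted.
  by move=> x y /=; have := ltn_ord y; lia.
apply: eq_mem_map => l; rewrite mem_enum.
by apply/imsetP/mapP => -[s sT ->]; exists s; rewrite ?mem_rev ?mem_enum //;
  move: sT; rewrite mem_rev mem_enum.
Qed.

End OrdinalSets.

Section MainIdentity.
Variables (R : realFieldType) (q : R).
Hypothesis hq : 0 < q < 1.

Let q0 : q != 0. Proof. by case/andP: hq => /lt0r_neq0. Qed.

Lemma exprz_inj : injective (exprz q).
Proof. by case/andP: hq => q_gt0 q_lt1; apply: ieexprIz; rewrite ?lt_eqF. Qed.

Lemma qpows_uniq (N : nat) (T : {set 'I_N}) : uniq (qpows q T).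
Proof.
rewrite map_inj_uniq ?enum_uniq // => s t E; apply: val_inj.
by have [] := @exprz_inj (Posz s) (Posz t) E.
Qed.

Lemma qpows_neq0 (N : nat) (T : {set 'I_N}) : all (predC1 0) (qpows q T).
Proof. by apply/allP => _ /mapP[t _ ->] /=; rewrite expf_neq0. Qed.

(** Up to transposition and reversal of its columns this is a Vandermonde matrix, with distinct
    nodes because the nu_k - k are distinct. *)
Lemma Wmx_unit (N : nat) (nu : seq int) : nu \in GT N -> Wmx q N nu \in unitmx.
Proof.
move=> nuGT; pose a : 'rV[R]_N := \row_k q ^ (nu`_k - k.+1%:Z).
have -> : Wmx q N nu
    = col_perm (perm (@rev_ord_inj N)) (Vandermonde N a)^T.
  by apply/matrixP => k l; rewrite !mxE permE.
rewrite col_permE unitmx_mul unitmx_perm andbT unitmx_tr unitmxE unitfE.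
rewrite det_Vandermonde; apply/prodf_neq0 => i _; apply/prodf_neq0 => j ltij.
rewrite !mxE subr_eq0; apply/eqP => /exprz_inj/(GT_node_inj nuGT) eqij.
by move: ltij; rewrite eqij ltnn.
Qed.

(** The transposed matrix of the determinantal formula is written as W times a matrix whose first
    [K] columns hold the functions psi and whose other columns are unit vectors scaled by q^(N t).
    These scalars and the sign of the expansion combine into the power of -q^N. *)
Lemma skew_schur_qpows (K N : nat) (kappa nu : seq int) (T : {set 'I_N}) :
  kappa \in GT K -> nu \in GT N -> N = (K + #|T|)%N ->
  skew_schur nu kappa (qpows q T) * vdm (qpows q T)
  = \det (Wmx q N nu) * (- q ^+ N) ^+ (\sum_(t in T) val t)%N
    * \det (\matrix_(i < K, j < K)
              [seq qpsi q nu T s (kappa`_j - j.+1%:Z) | s <- enum (Sprime T)]`_i).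
Proof.
move=> kGT nGT EN; have /andP[/eqP szk _] := kGT.
have sztT : size (enum T) = #|T| by rewrite -cardE.
rewrite (@skew_schur_det _ kappa _ nu K N) ?qpows_neq0 ?size_map ?sztT //.
set A := \matrix_(i, j) _; rewrite -[\det A]det_tr.
have Wu := Wmx_unit nGT.
rewrite -(mulKVmx Wu A^T) det_mulmx -mulrA; congr (_ * _).
pose t := map val (enum T).
have szt : size t = #|T| by rewrite size_map.
(* Rows are labelled by their distance [s] to the last row; this is the label under which [Sprime]
   is formed from the complement of [T]. *)
pose F s j := oapp (fun l : 'I_N => qpsi q nu T (rev_ord l)
                                      (kappa`_j - j.+1%:Z)) 0 (insub s).
pose c j := if (j < K)%N then 1 else (q ^+ N) ^+ nth 0%N t (j - K).
have -> : invmx (Wmx q N nu) *m A^T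
    = \matrix_(l < N, i < N)
        (c i * if (i < K)%N then F (N - l.+1)%N i
               else (N - l.+1 == nth 0 t (i - K))%N%:R).
  apply/matrixP => l i; rewrite [LHS]mxE [RHS]mxE /c.
  under eq_bigr do rewrite 2!mxE /jt_row szk.
  case: ltnP => [ltiK|leKi].
    rewrite mul1r /F -[(N - l.+1)%N]/(val (rev_ord l)) valK /= rev_ordK.
    by apply: eq_bigr => j _; rewrite mulrC.
  have lti : (i - K < size (enum T))%N by rewrite sztT ltn_subLR // -EN.
  have x0 : 'I_N := l.
  pose s := nth x0 (enum T) (i - K).
  have -> : (qpows q T)`_(i - K) = q ^+ s by rewrite (nth_map x0).
  have -> : nth 0%N t (i - K) = s by rewrite (nth_map x0).
  have -> : (N - l.+1 == s)%N = (l == rev_ord s).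
    by rewrite -[(N - l.+1)%N]/(val (rev_ord l)) (inj_eq val_inj)
               -(inj_eq rev_ord_inj) rev_ordK.
  (* Column [rev_ord s] of W has exponent [s], and q^(s (nu_j - j + N)) is q^(N s) times its entry,
     so W^{-1} yields a multiple of a unit vector. *)
  have := mulVmx Wu => /matrixP/(_ l (rev_ord s)); rewrite [RHS]mxE => <-.
  rewrite mxE big_distrr; apply: eq_bigr => j _ /=; rewrite mulrCA.
  congr (_ * _); rewrite mxE /=.
  have -> : (N - (N - s.+1).+1)%N = s by have := ltn_ord s; lia.
  by rewrite !exprnP !exprz_exp -expfzDr //; congr (q ^ _); ring.
have tN : all (ltn^~ N) t by apply/allP => _ /mapP[l _ ->] /=.
rewrite det_scale_cols det_unit_cols ?szt ?val_enum_sorted // mulrA.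
congr (_ * _).
  have -> : \sum_(s in T) val s = sumn t.
    by rewrite sumnE big_map big_enum.
  rewrite [RHS]exprNn [RHS]mulrC; congr (_ * _).
  rewrite -(big_mkord xpredT c) (@big_cat_nat _ _ _ K) //=; last by lia.
  rewrite big_nat_cond big1 ?mul1r; last first.
    by move=> i /andP[/andP[_ ltiK] _]; rewrite /c ltiK.
  rewrite -{1}[K]add0n big_addn (_ : (N - K)%N = #|T|); last by lia.
  rewrite sumnE [in RHS](big_nth 0%N) szt.
  rewrite -prodrXr; apply: eq_bigr => i _.
  by rewrite /c ltnNge leq_addl addnK.
congr (\det _); apply/matrixP => i j; rewrite !mxE complement_enum enum_Sprime.
have szc : size (rev (enum (~: T))) = K.
  by rewrite size_rev -cardE; have := cardsC T; rewrite card_ord; lia.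
have lti : (i < size (rev (enum (~: T))))%N by rewrite szc.
have x0 : 'I_N by apply: Ordinal (leq_trans (ltn_ord i) _); lia.
by rewrite -map_rev -map_comp !(nth_map x0) // /F valK.
Qed.

(** Reversing the order of the indices and using q^-(N-k) = q^k / q^N, each pair contributes a
    factor -q^-N. The number of pairs is 0 + 1 + ... + (N-1). *)
Lemma vdm_inv_qpows (N : nat) :
  vdm [seq q ^- i | i <- iota 1 N]
  = vdm (qpows q [set: 'I_N]) / (- q ^+ N) ^+ (\sum_(t in [set: 'I_N]) val t)%N.
Proof.
have szF : size (enum [set: 'I_N]) = N by rewrite -cardE cardsT card_ord.
rewrite /vdm !size_map size_iota szF.
have nthF (i : 'I_N) : (qpows q [set: 'I_N])`_i = q ^+ i.
  rewrite (nth_map i) ?szF // enum_setT -enumT; congr (q ^+ _).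
  exact: nth_enum_ord.
have nthV (i : 'I_N) : [seq q ^- i | i <- iota 1 N]`_i = q ^- i.+1.
  by rewrite (nth_map 0%N) ?size_iota // nth_iota // add1n.
pose c := (- q ^+ N)^-1.
have sub_rev (i j : 'I_N) :
    [seq q ^- i | i <- iota 1 N]`_(rev_ord i)
      - [seq q ^- i | i <- iota 1 N]`_(rev_ord j)
    = ((qpows q [set: 'I_N])`_j - (qpows q [set: 'I_N])`_i) * c.
  have qV (k : 'I_N) : q ^- (N - k.+1).+1 = q ^+ k / q ^+ N.
    rewrite -subSn ?ltn_ord // subSS.
    have -> : q ^+ N = q ^+ k * q ^+ (N - k).
      by rewrite -exprD subnKC // ltnW.
    by rewrite invfM mulrA mulfV ?mul1r ?expf_neq0.
  by rewrite !nthV !nthF !qV /c invrN mulrN -mulNr opprB mulrBl.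
rewrite (reindex_inj rev_ord_inj) /=.
under eq_bigr => i _.
  rewrite (reindex_inj rev_ord_inj) /=.
  under eq_bigr do rewrite sub_rev.
  under eq_bigl => j do
    rewrite (_ : (N - i.+1 < N - j.+1)%N = (j < i)%N) ?ltn_sub2lE ?ltnS//.
  rewrite big_split /= -(big_ord_widen _ (fun=> c)) ?(ltnW (ltn_ord i)) //.
  rewrite prodr_const card_ord.
  over.
rewrite big_split /= prodrXr -exprVn; congr (_ * _ ^+ _).
  by rewrite (exchange_big_dep xpredT).
by apply: eq_bigl => i; rewrite inE.
Qed.

End MainIdentity.

Theorem theorem6p1 (R : realFieldType) (q : R) (K N : nat)
    (kappa nu : seq int) (T : {set 'I_N})
    (hq : 0 < q < 1)
    (hKN : (1 <= K < N)%N)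
    (hkappa : kappa \in GT K)
    (hnu : nu \in GT N)
    (hT : #|T| = (N - K)%N) :
  skew_schur nu kappa (qpows q T) / schur nu [seq q ^+ i | i <- iota 0 N]
  = (- q ^+ N) ^+ (\sum_(t in T) val t)%N
    * (vdm [seq q ^- i | i <- iota 1 N] / vdm (qpows q T))
    * \det (\matrix_(i < K, j < K)
              [seq qpsi q nu T s (kappa`_j - j.+1%:Z) | s <- enum (Sprime T)]`_i).
Proof.
have qpowsT : qpows q [set: 'I_N] = [seq q ^+ i | i <- iota 0 N].
  by rewrite /qpows enum_setT -enumT -val_enum_ord -map_comp.
have /andP[_ ltKN] := hKN.
have EN : N = (K + #|T|)%N by rewrite hT; lia.
have nilGT : [::] \in GT 0 by [].
have EF : N = (0 + #|[set: 'I_N]|)%N by rewrite cardsT card_ord.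
have num := skew_schur_qpows hq hkappa hnu EN.
(* For empty [kappa] and the full set of exponents the determinant of psi is 0 by 0, hence equal to
   1. *)
have den := skew_schur_qpows hq nilGT hnu EF.
rewrite det_mx00 mulr1 qpowsT in den.
have VT0 := vdm_neq0 (qpows_uniq hq T).
have VF0 := vdm_neq0 (qpows_uniq hq [set: 'I_N]).
have W0 : \det (Wmx q N nu) != 0.
  by rewrite -unitfE -unitmxE Wmx_unit.
have c0 (n : nat) : (- q ^+ N) ^+ n != 0.
  by rewrite expf_neq0 // oppr_eq0 expf_neq0 //; case/andP: hq => /lt0r_neq0.
have -> : skew_schur nu kappa (qpows q T) = _ := canRL (mulfK VT0) num.
(* The full Vandermonde product over its power of -q^N is V(q^-1, ..., q^-N), and det W cancels in
   the quotient. *)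
rewrite vdm_inv_qpows // qpowsT in VF0 *.
have -> : schur nu [seq q ^+ i | i <- iota 0 N] = _ := canRL (mulfK VF0) den.
field.
by rewrite VT0 VF0 W0 !c0.
Qed.
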